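(* Fix $y\in\mathbb{R}$, a bandwidth $h>0$, a kernel $K$, integers $m,n\ge1$, and real observations $Y_1,\dots,Y_{n+1}$ (held fixed). Let $\Theta\subset\mathbb{R}^m$ be a convex open set. For a configuration $x=(x_1,\dots,x_{n+1})\in\{1,\dots,m\}^{n+1}$ and $\theta=(\theta_1,\dots,\theta_m)\in\Theta$ let $$U(\theta;x)=\frac{1}{nh}\sum_{k=1}^n\sum_{i=1}^mK_h(y-Y_k)\mathbf{1}_i(x_{k+1})(Y_{k+1}-\theta_i)^2.$$ Let $\pi$ be a fixed probability distribution on $\{1,\dots,m\}^{n+1}$ (the conditional law of the hidden states given the observations under a fixed parameter), and set $$u(\theta)=\frac{1}{nh}\sum_{k=1}^n\sum_{i=1}^mK_h(y-Y_k)\,\pi(x_{k+1}=i)\,(Y_{k+1}-\theta_i)^2 .$$ Let $X^1,X^2,\dots$ be random configurations such that, for each $t\ge1$, conditionally on $\mathcal{F}_{t-1}=\sigma(X^1,\dots,X^{t-1})$, $X^t$ has law $\pi$. Given $\theta^0\in\Theta$, define recursively $\theta^t=\theta^{t-1}-\gamma_t\nabla_\theta U(\theta^{t-1};X^t)$ and $\bar\theta^t=\frac1t\sum_{k=1}^t\theta^k$ (with $\bar\theta^0=\theta^0$). Assume $\{\gamma_t\}$ is a positive sequence with $\sum_t\gamma_t=\infty$ and $\sum_t\gamma_t^2<\infty$, and that the closure of $\{\bar\theta^t\}$ is a compact subset of $\Theta$. Then, almost surely, $\lim_{t\to\infty}\nabla_\theta u(\bar\theta^t)=0$; furthermore $\lim_{t\to\infty}\bar\theta^t=\theta^*$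 with $\nabla_\theta u(\theta^* )=0$, almost surely.
   Context: $K_h(v)=K(v/h)$ and $\mathbf{1}_i(x)$ is the indicator of $x=i$; $\pi(x_{k+1}=i)$ is the $\pi$-probability that the $(k+1)$-th coordinate equals $i$. In the paper's algorithm $\pi$ is the conditional distribution $p(X_{1:n}\mid Y_{0:n},\theta')$ of the hidden Markov regime of an MS-NAR model given the observations, sampled by a Carter–Kohn forward-filtering backward-sampling step, and $u$ is the conditional expectation of $U$ given $\mathcal{F}_{t-1}$. *)

(* Defs.v *)
From HB Require Import structures.
From mathcomp Require Import all_boot all_order all_algebra.
From mathcomp Require Import all_classical all_reals all_analysis.
Set Implicit Arguments. Unset Strict Implicit. Unset Printing Implicit Defensive.
Import Order.TTheory GRing.Theory Num.Theory.
Import numFieldNormedType.Exports.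
Local Open Scope classical_set_scope.
Local Open Scope ring_scope.

(* A configuration x = (x_1,...,x_{n+1}) in {1..m}^{n+1}:
   coordinate x_j (1 <= j <= n+1) is stored at index j-1 : 'I_n.+1,
   and state i in {1..m} is stored as i-1 : 'I_m. *)
Definition cfg (n m : nat) := {ffun 'I_n.+1 -> 'I_m}.

Section defs.
Variable R : realType.

Definition Kh (K : R -> R) (h v : R) : R := K (v / h).

(* "K is a kernel": nonnegative (the only kernel property relevant here) *)
Definition is_kernel (K : R -> R) : Prop := forall v, 0 <= K v.

Definition grad (m : nat) (f : 'rV[R]_m -> R) (th : 'rV[R]_m) : 'rV[R]_m :=
  \row_(i < m) ('D_(delta_mx 0 i) f th).

Variables (K : R -> R) (y h : R) (n m : nat) (Y : nat -> R).

Definition U_obj (theta : 'rV[R]_m) (x : cfg n m) : R :=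
  (n%:R * h)^-1 * \sum_(1 <= k < n.+1) \sum_(i < m)
     Kh K h (y - Y k) * ((x (inord k) == i)%:R) * (Y k.+1 - theta 0 i) ^+ 2.

Definition marg (pi : cfg n m -> R) (k : nat) (i : 'I_m) : R :=
  \sum_(c : cfg n m | c (inord k) == i) pi c.

Definition u_obj (pi : cfg n m -> R) (theta : 'rV[R]_m) : R :=
  (n%:R * h)^-1 * \sum_(1 <= k < n.+1) \sum_(i < m)
     Kh K h (y - Y k) * marg pi k i * (Y k.+1 - theta 0 i) ^+ 2.

Definition is_prob_on_cfg (pi : cfg n m -> R) : Prop :=
  (forall c, 0 <= pi c) /\ \sum_(c : cfg n m) pi c = 1.

Fixpoint sgd_iter (gamma : nat -> R) (th0 : 'rV[R]_m) (xs : nat -> cfg n m)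
    (t : nat) : 'rV[R]_m :=
  match t with
  | 0 => th0
  | t'.+1 => let p := sgd_iter gamma th0 xs t' in
             p - gamma t'.+1 *: grad (fun th => U_obj th (xs t'.+1)) p
  end.

Definition sgd_avg (gamma : nat -> R) (th0 : 'rV[R]_m) (xs : nat -> cfg n m)
    (t : nat) : 'rV[R]_m :=
  if t is 0 then th0
  else t%:R^-1 *: \sum_(1 <= k < t.+1) sgd_iter gamma th0 xs k.

Definition convex_rV (Theta : set 'rV[R]_m) : Prop :=
  forall a b (l : R), Theta a -> Theta b -> 0 <= l -> l <= 1 ->
    Theta (l *: a + (1 - l) *: b).

(* For every t >= 1, conditionally on F_{t-1} = sigma(X^1,...,X^{t-1}),
   X^t has law pi: every F_{t-1}-event is of the form
   {(X^1,...,X^{t-1}) in B} (the configurations take finitely many values). *)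
Definition cond_law_pi (d : measure_display) (T : measurableType d)
    (P : probability T R) (X : nat -> T -> cfg n m) (pi : cfg n m -> R) : Prop :=
  forall t, (0 < t)%N ->
  forall (B : set {ffun 'I_t.-1 -> cfg n m}) (c : cfg n m),
    P ([set w | B [ffun j : 'I_t.-1 => X j.+1 w]] `&` [set w | X t w = c])
    = ((pi c)%:E * P [set w | B [ffun j : 'I_t.-1 => X j.+1 w]])%E.

End defs.

(* Main.v *)
Require Import Defs.
From HB Require Import structures.
From mathcomp Require Import all_boot all_order all_algebra.
From mathcomp Require Import all_classical all_reals all_analysis.
From mathcomp Require Import ring lra.
Set Implicit Arguments. Unset Strict Implicit. Unset Printing Implicit Defensive.
Import Order.TTheory GRing.Theory Num.Theory.
Import numFieldNormedType.Exports.
Local Open Scope classical_set_scope.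
Local Open Scope ring_scope.

(* The gradients are affine and diagonal: the i-th coordinate of the gradient of
   U(.; x) is a_i(x) th_i - b_i(x) with a_i >= 0, so every coordinate follows a
   scalar linear stochastic approximation scheme. If the mean A of a_i under pi
   vanishes, then a_i = b_i = 0 almost surely and the coordinate never moves.
   Otherwise V = (th_i - B / A)^2, with B the mean of b_i, satisfies
   E[V_(t+1) | F_t] <= V_t - A gamma_(t+1) V_t + K gamma_(t+1)^2 eventually.
   Adding the tail K sum_(s > t) gamma_s^2 to V yields a nonnegative
   supermartingale whose expectation comes arbitrarily close to 0, because
   sum gamma = oo; by the maximal inequality it tends to 0 almost surely. The
   averages then converge by Cesaro's lemma. *)

(** * Expectations over finite histories of independent draws *)

Section mean.
Context {R : realType} {C : finType} (pi : C -> R).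
Hypotheses (pi_ge0 : forall c, 0 <= pi c) (pi_sum1 : \sum_c pi c = 1).

(** Conditional expectation given the past [s], the next draw having law [pi]. Iterated in [histE],
    which integrates out the newest draw first, it gives the expectation under the [t]-fold product
    of [pi]. *)
Definition stepE (g : seq C -> R) (s : seq C) : R := \sum_c pi c * g (c :: s).

(* Histories are listed most recent first. *)
Fixpoint histE (t : nat) (g : seq C -> R) : R :=
  if t is t'.+1 then histE t' (stepE g) else g [::].

Lemma ler_stepE (g1 g2 : seq C -> R) s :
  (forall c, g1 (c :: s) <= g2 (c :: s)) -> stepE g1 s <= stepE g2 s.
Proof. by move=> g12; apply: ler_sum => c _; rewrite ler_wpM2l. Qed.

Lemma stepE_lin (a b k : R) (g1 g2 : seq C -> R) s :
  stepE (fun s' => a * g1 s' + b * g2 s' + k) s =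
  a * stepE g1 s + b * stepE g2 s + k.
Proof.
rewrite /stepE -[in RHS](mul1r k) -pi_sum1 mulr_suml !mulr_sumr -!big_split /=.
by apply: eq_bigr => c _; ring.
Qed.

Lemma eq_histE t (g1 g2 : seq C -> R) :
  (forall s, size s = t -> g1 s = g2 s) -> histE t g1 = histE t g2.
Proof.
elim: t g1 g2 => [|t IH] g1 g2 g12 /=; first exact: g12.
by apply: IH => s st; apply: eq_bigr => c _; rewrite g12 //= st.
Qed.

Lemma ler_histE t (g1 g2 : seq C -> R) :
  (forall s, size s = t -> g1 s <= g2 s) -> histE t g1 <= histE t g2.
Proof.
elim: t g1 g2 => [|t IH] g1 g2 g12 /=; first exact: g12.
by apply: IH => s st; apply: ler_stepE => c; rewrite g12 //= st.
Qed.

Lemma histE_lin t (a b k : R) (g1 g2 : seq C -> R) :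
  histE t (fun s => a * g1 s + b * g2 s + k) =
  a * histE t g1 + b * histE t g2 + k.
Proof.
elim: t g1 g2 => [//|t IH] g1 g2 /=; rewrite -IH; apply: eq_histE => s _.
exact: stepE_lin.
Qed.

Lemma histE_const t (k : R) : histE t (fun=> k) = k.
Proof.
transitivity (histE t (fun=> 0 * 0 + 0 * 0 + k)).
  by apply: eq_histE => s _; rewrite !mul0r !add0r.
by rewrite histE_lin !mul0r !add0r.
Qed.

Lemma histE_sum t (I : Type) (r : seq I) (a : I -> R) (g : I -> seq C -> R) :
  histE t (fun s => \sum_(i <- r) a i * g i s) =
  \sum_(i <- r) a i * histE t (g i).
Proof.
elim: r => [|i r IH].
  rewrite big_nil -[RHS](histE_const t); apply: eq_histE => s _.
  by rewrite big_nil.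
rewrite big_cons -IH.
transitivity (histE t (fun s => a i * g i s +
    1 * (\sum_(j <- r) a j * g j s) + 0)).
  by apply: eq_histE => s _; rewrite big_cons mul1r addr0.
by rewrite histE_lin mul1r addr0.
Qed.

(** * Maximal inequality for nonnegative supermartingales *)

Section maximal.
Variables (W : seq C -> R) (e : R) (N : nat).
Hypotheses (W_ge0 : forall s, 0 <= W s) (e_gt0 : 0 < e).
Hypothesis W_super : forall s, (N <= size s)%N -> stepE W s <= W s.

Fixpoint exceeds (s : seq C) : bool :=
  (N <= size s)%N && (e <= W s) || (if s is _ :: s' then exceeds s' else false).

Lemma exceeds_lt s : (size s < N)%N -> exceeds s = false.
Proof.
elim: s => [|c s IH] /= sN; first by rewrite leqNgt sN.
by rewrite leqNgt sN /= IH // ltnW.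
Qed.

(* Replacing [W] by the constant [e] from the first excess on keeps it a
   supermartingale, because [e <= W] at that time. *)
Let M s := if exceeds s then e else W s.

(** Optional stopping at the first excess: [M] dominates [e] times the indicator of an excess, its
    mean does not increase after time [N], and [M <= W] at time [N]. *)
Lemma maximal_ineq t :
  (N <= t)%N -> e * histE t (fun s => (exceeds s)%:R) <= histE N W.
Proof.
(* At a first excess [e <= W s], so [M] can top [W] only after an earlier one. *)
move=> Nt; have leM s : (N <= size s)%N -> M s <= W s \/
    (exists c s', s = c :: s' /\ exceeds s').
  rewrite /M; case: s => [|c s] /= Ns.
    by left; rewrite Ns orbF; case: ifP.
  rewrite Ns /=; case: (leP e (W (c :: s))) => eW /=; first by left.
  by case: ifP => es; [right; exists c, s | left].
have stepM s : (N <= size s)%N -> stepE M s <= M s.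
  move=> Ns; rewrite {2}/M; case: ifPn => es.
    rewrite /stepE (eq_bigr (fun c => pi c * e)) => [|c _].
      by rewrite -mulr_suml pi_sum1 mul1r.
    by rewrite /M /= es orbT.
  apply: le_trans (W_super Ns); apply: ler_stepE => c.
  have /leM[//|[c' [s' [[_ <-] es']]]] : (N <= size (c :: s))%N by exact: leqW.
  by rewrite es' in es.
have {stepM} : histE t M <= histE N M.
  elim: t Nt => [|t IH]; first by rewrite leqn0 => /eqP ->.
  rewrite leq_eqVlt => /predU1P[<- //|]; rewrite ltnS => Nt.
  by apply: le_trans (IH Nt) => /=; apply: ler_histE => s st; rewrite stepM ?st.
(* At time [N] every strictly earlier history is too short to count, so an excess is the present
   one. *)
have leMN : histE N M <= histE N W.
  apply: ler_histE => s sN; rewrite /M; case: s sN => [|c s] /= sN.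
    by rewrite -sN /= orbF; case: ifP.
  by rewrite -{1}sN leqnn /= [exceeds s]exceeds_lt ?sN -?sN // orbF; case: ifP.
move=> leM1; apply: le_trans (le_trans leM1 leMN).
have <- : histE t (fun s => e * (exceeds s)%:R + 0 * 0 + 0) =
    e * histE t (fun s => (exceeds s)%:R).
  by rewrite (histE_lin _ _ _ _ _ (fun=> 0)) histE_const mul0r !addr0.
apply: ler_histE => s _; rewrite mulr0 !addr0 /M.
by case: ifP => _; rewrite ?mulr1 ?mulr0.
Qed.

Lemma exceedsP (x : nat -> C) (hist : nat -> seq C) :
  hist 0 = [::] -> (forall t, hist t.+1 = x t :: hist t) ->
  forall t, exceeds (hist t) <->
            exists2 k, (N <= k <= t)%N & e <= W (hist k).
Proof.
move=> h0 hS; have hsz t : size (hist t) = t.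
  by elim: t => [|t IH]; rewrite ?h0 // hS /= IH.
elim=> [|t IH].
  rewrite h0 /= orbF; split=> [/andP[N0 eW]|[k /andP[Nk]]].
    by exists 0%N; rewrite ?h0 ?N0.
  by rewrite leqn0 => /eqP k0; move: Nk; rewrite k0 h0 => -> ->.
rewrite hS /= hsz -hS; split=> [/orP[/andP[Nt eW]|/IH[k /andP[Nk kt] eW]]|].
- by exists t.+1; rewrite ?Nt /=.
- by exists k; rewrite ?Nk ?leqW.
- move=> [k /andP[Nk]]; rewrite leq_eqVlt => /predU1P[kt|kt] eW.
    by rewrite -kt Nk eW.
  by apply/orP; right; apply/IH; exists k; rewrite ?Nk.
Qed.
End maximal.
End mean.

(** * From finite histories to almost sure convergence *)

Section almost_sure.
Context {R : realType} {C : finType} (pi : C -> R).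
Hypotheses (pi_ge0 : forall c, 0 <= pi c) (pi_sum1 : \sum_c pi c = 1).
Context (d : measure_display) (T : measurableType d) (P : probability T R).
Variable X : nat -> T -> C.

Fixpoint hist (x : nat -> C) (t : nat) : seq C :=
  if t is t'.+1 then x t :: hist x t' else [::].

Lemma size_hist x t : size (hist x t) = t.
Proof. by elim: t => [//|t IH] /=; rewrite IH. Qed.

Definition hist_event (t : nat) (B : pred (seq C)) : set T :=
  [set w | B (hist (X^~ w) t)].

Hypothesis mX : forall t c, measurable (X t @^-1` [set c]).
Hypothesis lawX : forall t (B : pred (seq C)) c,
  P (hist_event t B `&` X t.+1 @^-1` [set c]) = ((pi c)%:E * P (hist_event t B))%E.

Lemma hist_eventS t B : hist_event t.+1 B = \bigcup_(c in [set: C])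
  (hist_event t (fun s => B (c :: s)) `&` X t.+1 @^-1` [set c]).
Proof.
apply/seteqP; split=> w; first by move=> Bw; exists (X t.+1 w).
by move=> [c _ [Bw Xc]]; rewrite /hist_event /= Xc.
Qed.

Lemma measurable_hist_event t B : measurable (hist_event t B).
Proof.
elim: t B => [|t IH] B.
  rewrite /hist_event /=; case: (B [::]).
    by rewrite (_ : [set w | _] = setT) //; apply/seteqP; split.
  by rewrite (_ : [set w | _] = set0) //; apply/seteqP; split.
rewrite hist_eventS; apply: fin_bigcup_measurable; first exact: finite_finset.
by move=> c _; apply: measurableI.
Qed.

(** Splitting on the newest draw, whose conditional law is [pi], shows by induction that histories
    follow the product law. *)
Lemma prob_hist_event t B :
  P (hist_event t B) = (histE pi t (fun s => (B s)%:R))%:E.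
Proof.
elim: t B => [|t IH] B.
  rewrite /hist_event /=; case: (B [::]).
    rewrite (_ : [set w | _] = setT) ?probability_setT //.
    by apply/seteqP; split.
  by rewrite (_ : [set w | _] = set0) ?measure0 //; apply/seteqP; split.
rewrite hist_eventS measure_fin_bigcup; first last.
- by move=> c _; apply: measurableI => //; exact: measurable_hist_event.
- by move=> c c' _ _ [w /= [[_ <-] [_ <-]]].
- exact: finite_finset.
rewrite (_ : [set: C] = [set` index_enum C]); last first.
  by apply/seteqP; split=> c //= _; rewrite mem_index_enum.
rewrite -fsbig_seq ?index_enum_uniq //=.
under eq_bigr do rewrite lawX IH -EFinM.
by rewrite sumEFin -histE_sum.
Qed.

(** Infinitely many excesses of [e] force an excess after every late [N], which has probability at
    most [histE pi N W / e]; this bound is arbitrarily small for suitable [N]. *)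
Lemma supermartingale_cvg0 (W : seq C -> R) (N0 : nat) :
  (forall s, 0 <= W s) ->
  (forall s, (N0 <= size s)%N -> stepE pi W s <= W s) ->
  (forall e N, 0 < e -> exists2 t, (N <= t)%N & histE pi t W < e) ->
  {ae P, forall w, W (hist (X^~ w) t) @[t --> \oo] --> (0 : R)}.
Proof.
move=> W0 Wsuper Wsmall.
pose bad (e : R) := [set w | forall N, exists2 k, (N <= k)%N &
                               e <= W (hist (X^~ w) k)].
have late N e : 0 < e -> (N0 <= N)%N -> let A := \bigcup_t
    hist_event t (exceeds W e N) in
    [/\ measurable A, bad e `<=` A & (P A <= (histE pi N W / e)%:E)%E].
  move=> e0 NN A.
  have mA : measurable A.
    by apply: bigcup_measurable => t _; exact: measurable_hist_event.
  have exc := fun w => exceedsP W e N (x := fun t => X t.+1 w)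
    (hist := hist (X^~ w)) erefl (fun=> erefl).
  split=> //.
    move=> w /(_ N)[k Nk ek]; exists k => //=; apply/exc.
    by exists k; rewrite ?Nk /=.
  (* Continuity from below: the events with horizon [t] increase to [A], so the finite-horizon bound
     passes to the limit. *)
  have cvA : P (hist_event t (exceeds W e N)) @[t --> \oo] --> P A.
    apply: nondecreasing_cvg_mu => // [t|t t' tt'].
      exact: measurable_hist_event.
    apply/subsetPset => w /exc[k /andP[Nk kt] ek]; apply/exc.
    by exists k => //; rewrite Nk (leq_trans kt).
  rewrite -(cvg_lim _ cvA) //; apply: lime_le.
    by apply/cvg_ex; eexists; exact: cvA.
  near=> t; rewrite /= prob_hist_event lee_fin ler_pdivlMr // mulrC.
  apply: maximal_ineq => //.
    by move=> s Ns; apply: Wsuper; exact: leq_trans Ns.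
  by near: t; exact: nbhs_infty_ge.
have bad0 e : 0 < e -> P.-negligible (bad e).
  move=> e0.
  pose A N := \bigcup_t hist_event t (exceeds W e N).
  have mcap : measurable (\bigcap_k A (N0 + k)%N).
    apply: bigcap_measurable => [|k _]; first by exists 0%N.
    by have [] := late (N0 + k)%N _ e0 (leq_addr _ _).
  exists (\bigcap_k A (N0 + k)%N); split => //.
  - apply/eqP; rewrite eq_le measure_ge0 andbT; apply/lee_addgt0Pr => del del0.
    (* The level [del * e] becomes [del] after the division by [e] in the maximal bound. *)
    rewrite add0e; have [N NN EN] := Wsmall (del * e) N0 (mulr_gt0 del0 e0).
    have [mA _ PA] := late N e e0 NN.
    apply: (@le_trans _ _ (P (A N))).
      apply: le_measure; rewrite ?inE //.
      by move=> w /(_ (N - N0)%N I); rewrite subnKC.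
    by apply: le_trans PA _; rewrite lee_fin ler_pdivrMr // ltW.
  - move=> w bw k _.
    by have [_ + _] := late (N0 + k)%N _ e0 (leq_addr _ _); exact.
(* Countably many thresholds suffice: off this union [W] eventually falls below each of them. *)
have : P.-negligible (\bigcup_k bad k.+1%:R^-1).
  by apply: negligible_bigcup => k; apply: bad0; rewrite invr_gt0.
apply: negligibleS => w /= ncv.
apply: contrapT => nbad; apply: ncv; apply/cvgrPdist_lt => e e0.
have [k ke] : exists k : nat, k.+1%:R^-1 < e.
  exists (Num.truncn e^-1); rewrite invf_plt ?posrE //.
  exact: truncnS_gt.
have : ~ bad k.+1%:R^-1 w by move=> bk; apply: nbad; exists k.
move=> /existsNP[N nN]; exists N => // t /= Nt.
rewrite sub0r normrN ger0_norm // ltNge; apply/negP => et.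
by apply: nN; exists t => //; apply: le_trans et; exact: ltW.
Unshelve. all: by end_near.
Qed.

End almost_sure.

(** If [v] stayed above [e], each step would lower it by at least [A * e * gamma], up to errors of
    total at most [K * L]; as the steps sum to infinity, [v] would become negative. *)
Lemma contraction_inf0 (R : realType) (v gamma : nat -> R) (A K L : R) (N0 : nat) :
  0 < A -> 0 <= K -> (forall t, 0 <= v t) ->
  (forall t, (0 < t)%N -> 0 < gamma t) ->
  ((fun N => \sum_(1 <= t < N) gamma t) @ \oo --> +oo) ->
  (forall N, \sum_(1 <= t < N) gamma t ^+ 2 <= L) ->
  (forall t, (N0 <= t)%N ->
     v t.+1 <= v t - A * gamma t.+1 * v t + K * gamma t.+1 ^+ 2) ->
  forall e N, 0 < e -> exists2 t, (N <= t)%N & v t < e.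
Proof.
move=> A0 K0 v0 g0 Gy SL vrec e N e0; apply: contrapT => nex.
have {nex} ve t : (N <= t)%N -> e <= v t.
  by move=> Nt; rewrite leNgt; apply/negP => vt; apply: nex; exists t.
pose M := maxn N N0.
pose G n := \sum_(1 <= t < n) gamma t; pose S n := \sum_(1 <= t < n) gamma t ^+ 2.
have GS n : G n.+2 = G n.+1 + gamma n.+1 by rewrite /G big_nat_recr.
have SS n : S n.+2 = S n.+1 + gamma n.+1 ^+ 2 by rewrite /S big_nat_recr.
(* [G n] stops at [n - 1], so the difference collects the steps from [M + 1] to [M + k]. *)
have sum k : v (M + k)%N + A * e * (G (M + k).+1 - G M.+1) <=
             v M + K * (S (M + k).+1 - S M.+1).
  elim: k => [|k IH]; first by rewrite addn0 !subrr !mulr0.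
  rewrite addnS; set j := (M + k)%N in IH *.
  have Nj : (N <= j)%N by rewrite (leq_trans (leq_maxl N N0)) ?leq_addr.
  have N0j : (N0 <= j)%N by rewrite (leq_trans (leq_maxr N N0)) ?leq_addr.
  rewrite GS SS.
  have := vrec _ N0j; have : A * gamma j.+1 * e <= A * gamma j.+1 * v j.
    by rewrite ler_wpM2l ?ve // mulr_ge0 // ltW // g0.
  by move: IH; rewrite !mulrBr !mulrDr; lra.
have {}SL N' : S N' <= L := SL N'.
have {}Gy : G @ \oo --> +oo := Gy.
have S0 : 0 <= S M.+1 by apply: sumr_ge0 => t _; exact: sqr_ge0.
(* This growth of [G] costs [v] at least [v M + K * L + 1], one more than is available. *)
clearbody S G M; have /cvgryPge/(_ (G M.+1 + (v M + K * L + 1) / (A * e))) := Gy.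
move=> [k _ Hk].
have := Hk (M + k).+1; rewrite /= ltnW ?ltnS ?leq_addl // => /(_ isT) Gk.
have := sum k; have := v0 (M + k)%N; have := v0 M.
have : K * (S (M + k).+1 - S M.+1) <= K * L.
  by rewrite ler_wpM2l //; have := SL (M + k).+1; lra.
have Ae : 0 < A * e by rewrite mulr_gt0.
have : v M + K * L + 1 <= A * e * (G (M + k).+1 - G M.+1).
  by rewrite [leRHS]mulrC -ler_pdivrMr // lerBrDl.
lra.
Qed.

(** * Scalar linear stochastic approximation *)

Section linear_stochastic_approximation.
Context {R : realType} {C : finType} (pi : C -> R).
Hypotheses (pi_ge0 : forall c, 0 <= pi c) (pi_sum1 : \sum_c pi c = 1).
Context (d : measure_display) (T : measurableType d) (P : probability T R).
Variable X : nat -> T -> C.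
Hypothesis mX : forall t c, measurable (X t @^-1` [set c]).
Hypothesis lawX : forall t (B : pred (seq C)) c,
  P (hist_event X t B `&` X t.+1 @^-1` [set c]) =
  ((pi c)%:E * P (hist_event X t B))%E.
Variables (gamma : nat -> R) (a b : C -> R) (x0 : R).

(** [size s] counts the newest draw, so it is the index of the step being taken. *)
Fixpoint lsa (s : seq C) : R :=
  if s is c :: s' then lsa s' - gamma (size s) * (a c * lsa s' - b c) else x0.

Let cvg_of_sqr (xs : R) (W : seq C -> R) :
  (forall s, (lsa s - xs) ^+ 2 <= W s) ->
  {ae P, forall w, W (hist (X^~ w) t) @[t --> \oo] --> (0 : R)} ->
  {ae P, forall w, lsa (hist (X^~ w) t) @[t --> \oo] --> xs}.
Proof.
move=> VW; apply: filterS => w /cvgrPdist_lt cW.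
apply/cvgrPdist_lt => e e0; have e20 : 0 < e ^+ 2 by rewrite exprn_gt0.
apply: filterS (cW _ e20) => t; rewrite sub0r normrN => We.
rewrite -(ltr_pXn2r (n := 2)) ?nnegrE // ?ltW // real_normK ?num_real //.
rewrite -sqrrN opprB; apply: le_lt_trans (VW _) _.
by apply: le_lt_trans We; exact: ler_norm.
Qed.

(** Every draw of positive mass leaves the iterate fixed, so the squared distance to [x0] has mean 0
    at all times. *)
Lemma lsa_cvg_degenerate :
  (forall c, pi c * a c = 0) -> (forall c, pi c * b c = 0) ->
  {ae P, forall w, lsa (hist (X^~ w) t) @[t --> \oo] --> x0}.
Proof.
move=> a0 b0; pose V s := (lsa s - x0) ^+ 2.
have stepV s : stepE pi V s = V s.
  rewrite -[RHS]mul1r -pi_sum1 mulr_suml; apply: eq_bigr => c _.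
  have [->|pc] := eqVneq (pi c) 0; first by rewrite !mul0r.
  have ac : a c = 0 by have /eqP := a0 c; rewrite mulf_eq0 (negPf pc) => /eqP.
  have bc : b c = 0 by have /eqP := b0 c; rewrite mulf_eq0 (negPf pc) => /eqP.
  by rewrite /V /= ac bc mul0r subrr mulr0 subr0.
have EV t : histE pi t V = 0.
  elim: t => [|t IH] /=; first by rewrite /V /= subrr expr0n.
  by rewrite -IH; apply: eq_histE.
apply: (@cvg_of_sqr _ V) => //.
apply: (@supermartingale_cvg0 _ _ pi _ _ _ _ _ _ _ _ _ 0) => //.
- by move=> s; exact: sqr_ge0.
- by move=> s _; rewrite stepV.
- by move=> e N e0; exists N; rewrite ?EV.
Qed.

Hypothesis gamma_gt0 : forall t, (0 < t)%N -> 0 < gamma t.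
Hypothesis gamma_sum : (fun N => \sum_(1 <= t < N) gamma t) @ \oo --> +oo.
Hypothesis gamma_sqr_sum : cvg ((fun N => \sum_(1 <= t < N) gamma t ^+ 2) @ \oo).

Lemma lsa_cvg :
  0 < \sum_c pi c * a c ->
  {ae P, forall w, lsa (hist (X^~ w) t) @[t --> \oo] -->
                   (\sum_c pi c * b c) / (\sum_c pi c * a c)}.
Proof.
set A := \sum_c pi c * a c; set xs := _ / A => A0.
(* [xi] is the centred noise at the root [xs]: with [e = lsa s - xs], a step subtracts
   [g * (a c * e + xi c)]. *)
pose xi c := a c * xs - b c.
have xi0 : \sum_c pi c * xi c = 0.
  rewrite (eq_bigr (fun c => xs * (pi c * a c) - pi c * b c)); last first.
    by move=> c _; rewrite /xi; ring.
  by rewrite big_split /= -mulr_sumr sumrN -/A mulfVK ?subrr // gt_eqF.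
pose V s := (lsa s - xs) ^+ 2.
(* The factors 2 come from [(p + q)^2 <= 2 p^2 + 2 q^2], applied to [p = a c * e] and [q = xi c]. *)
pose Ka := 2 * \sum_c pi c * a c ^+ 2; pose Kx := 2 * \sum_c pi c * xi c ^+ 2.
have Ka0 : 0 <= Ka.
  by rewrite mulr_ge0 // sumr_ge0 // => c _; rewrite mulr_ge0 // sqr_ge0.
have Kx0 : 0 <= Kx.
  by rewrite mulr_ge0 // sumr_ge0 // => c _; rewrite mulr_ge0 // sqr_ge0.
pose S n := \sum_(1 <= t < n) gamma t ^+ 2; pose L := limn S.
have SL n : S n <= L.
  apply: nondecreasing_cvgn_le => //; apply/nondecreasing_seqP => k.
  case: k => [|k]; first by rewrite /S !big_geq.
  by rewrite /S (big_nat_recr k.+1) //= lerDl sqr_ge0.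
have Stail e : 0 < e -> exists N, forall n, (N <= n)%N -> L - S n < e.
  move=> e0; have /cvgrPdist_lt/(_ _ e0)[N _ HN] := gamma_sqr_sum.
  exists N => n Nn; apply: le_lt_trans (HN _ Nn); exact: ler_norm.
have SS n : S n.+2 = S n.+1 + gamma n.+1 ^+ 2 by rewrite /S big_nat_recr.
have stepV s : let g := gamma (size s).+1 in
    stepE pi V s <= V s - 2 * A * g * V s + g ^+ 2 * (Ka * V s + Kx).
  move=> g; set e := lsa s - xs.
  have -> : V s = e ^+ 2 by [].
  rewrite /stepE; apply: (@le_trans _ _ (\sum_c (e ^+ 2 * pi c -
      2 * g * e ^+ 2 * (pi c * a c) - 2 * g * e * (pi c * xi c) +
      g ^+ 2 * e ^+ 2 * 2 * (pi c * a c ^+ 2) +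
      g ^+ 2 * 2 * (pi c * xi c ^+ 2)))).
    apply: ler_sum => c _.
    have -> : V (c :: s) = (e - g * (a c * e + xi c)) ^+ 2.
      by rewrite /V /= -/g /xi /e; congr (_ ^+ 2); ring.
    (* The gap in that inequality is exactly the square of [p - q]. *)
    have h : 0 <= pi c * (g ^+ 2 * (a c * e - xi c) ^+ 2).
      by apply: mulr_ge0 => //; apply: mulr_ge0; exact: sqr_ge0.
    rewrite -subr_ge0; apply: le_trans h _.
    by rewrite le_eqVlt; apply/orP; left; apply/eqP; ring.
  rewrite !big_split /= !sumrN -!mulr_sumr pi_sum1 xi0 -/A /Ka /Kx.
  by rewrite le_eqVlt; apply/orP; left; apply/eqP; ring.
(* From [N0] on, the term [g ^+ 2 * Ka * V] absorbs at most half of the drift [2 * A * g * V]. A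
   single squared step is at most a tail of the convergent series; [Ka + 1] keeps the divisor
   positive. *)
have [N0 gN0] : exists N0, forall t, (N0 <= t)%N -> gamma t.+1 * Ka <= A.
  have del0 : 0 < A / (Ka + 1) by rewrite divr_gt0 // ltr_wpDl.
  have [N HN] := Stail _ (exprn_gt0 2 del0); exists N => t Nt.
  have gt0 := gamma_gt0 (ltn0Sn t).
  have : gamma t.+1 < A / (Ka + 1).
    rewrite -(ltr_pXn2r (n := 2)) ?nnegrE ?ltW //.
    by have := HN _ (leqW Nt); have := SL t.+2; rewrite SS; lra.
  by rewrite ltr_pdivlMr ?ltr_wpDl //; lra.
have stepV' s : (N0 <= size s)%N -> stepE pi V s <=
    V s - A * gamma (size s).+1 * V s + Kx * gamma (size s).+1 ^+ 2.
  move=> Ns; set g := gamma _; apply: le_trans (stepV s) _; rewrite -/g.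
  have g0 : 0 < g by exact: gamma_gt0.
  have h : 0 <= g * V s * (A - g * Ka).
    apply: mulr_ge0; last by rewrite subr_ge0 gN0.
    by apply: mulr_ge0; [exact: ltW | exact: sqr_ge0].
  rewrite -subr_ge0; apply: le_trans h _.
  by rewrite le_eqVlt; apply/orP; left; apply/eqP; ring.
(* [S (size s).+1] stops at [size s], so the added term is the budget for all future noise; each
   step spends exactly its own [Kx * gamma ^+ 2]. *)
pose W s := V s + Kx * (L - S (size s).+1).
have EW t : histE pi t W = histE pi t V + Kx * (L - S t.+1).
  transitivity (histE pi t (fun s => 1 * V s + 0 * 0 + Kx * (L - S t.+1))).
    by apply: eq_histE => s st; rewrite /W st mul1r mul0r addr0.
  by rewrite (histE_lin _ _ _ _ _ _ (fun=> 0)) // mul1r mul0r addr0.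
have tail0 n : 0 <= Kx * (L - S n) by rewrite mulr_ge0 // subr_ge0.
apply: (@cvg_of_sqr _ W); first by move=> s; rewrite lerDl.
apply: (@supermartingale_cvg0 _ _ pi _ _ _ _ _ _ _ _ _ N0) => //.
- by move=> s; rewrite addr_ge0 ?sqr_ge0.
- move=> s Ns.
  have -> : stepE pi W s = stepE pi V s + Kx * (L - S (size s).+2).
    rewrite -[stepE pi V s]mul1r -[1 * _]addr0.
    rewrite -[X in _ + X + _](mul0r (stepE pi V s)).
    rewrite -stepE_lin //; apply: eq_bigr => c _.
    by rewrite /W /= mul1r mul0r addr0.
  have := stepV' s Ns; rewrite /W SS.
  have : 0 <= A * gamma (size s).+1 * V s.
    apply: mulr_ge0; last exact: sqr_ge0.
    by apply: mulr_ge0; apply: ltW => //; exact: gamma_gt0.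
  by move=> /=; rewrite !mulrBr !mulrDr; lra.
- move=> e N e0.
  (* Half of [e] is for the mean of [V], small at arbitrarily late times, and half for the noise
     tail. *)
  have Kx1 : 0 < Kx + 1 by rewrite ltr_wpDl.
  have e20 : 0 < e / 2 by rewrite divr_gt0.
  have [N1 HN1] := Stail (e / 2 / (Kx + 1)) (divr_gt0 e20 Kx1).
  have [||t] := @contraction_inf0 _ (fun t => histE pi t V) gamma A Kx L N0
    A0 Kx0 _ gamma_gt0 gamma_sum SL _ (e / 2) (maxn N N1) e20.
  + move=> t; rewrite -(histE_const pi_sum1 t 0); apply: ler_histE => // s _.
    exact: sqr_ge0.
  + move=> t N0t /=.
    have -> : histE pi t V - A * gamma t.+1 * histE pi t V +
        Kx * gamma t.+1 ^+ 2 = 1 * histE pi t V + - (A * gamma t.+1) * histE pi t V +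
        Kx * gamma t.+1 ^+ 2 by rewrite mul1r mulNr.
    rewrite -histE_lin //; apply: ler_histE => // s st.
    by rewrite mul1r mulNr -st; apply: stepV'; rewrite st.
  + rewrite geq_max => /andP[Nt N1t] Et; exists t => //; rewrite EW.
    have := HN1 _ (leqW N1t); rewrite ltr_pdivlMr // mulrDr mulr1 => HH.
    have := SL t.+1; rewrite [Kx * _]mulrC.
    by move: HH Et; lra.
Qed.

End linear_stochastic_approximation.

(** The difference quotient is [G + t * Q] for nonzero [t]. *)
Lemma derive_quadratic (R : realType) (V : normedModType R) (f : V -> R)
    (x v : V) (G Q : R) :
  (forall t, f (t *: v + x) = f x + t * G + t ^+ 2 * Q) -> 'D_v f x = G.
Proof.
move=> fE; apply: cvg_lim => //.
have : (fun t : R => G + t * Q) @ 0^' --> G + 0 * Q.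
  apply: cvg_within_filter; apply: cvgD; first exact: cvg_cst.
  by apply: cvgMl; exact: cvg_id.
rewrite mul0r addr0; apply: cvg_trans; apply: near_eq_cvg; near=> t.
have t0 : t != 0 by near: t; exact: nbhs_dnbhs_neq.
by rewrite /= fE /GRing.scale /=; field; exact: t0.
Unshelve. all: by end_near.
Qed.

Lemma cvg_row (R : realType) (m : nat) (u : nat -> 'rV[R]_m) (l : 'rV[R]_m) :
  (forall i, u t 0 i @[t --> \oo] --> l 0 i) -> u t @[t --> \oo] --> l.
Proof.
move=> ul; apply/cvgrPdist_le => e e0.
have : \forall t \near \oo, forall i, `|l 0 i - u t 0 i| <= e.
  by apply: filter_forall => i; have /cvgrPdist_le := ul i; exact.
apply: filterS => t ute; rewrite /Num.norm /= mx_normrE.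
apply: bigmax_le => [|[i j] _ /=]; first exact: ltW.
by rewrite ord1 !mxE.
Qed.

(** * Affine gradients of the two objectives *)

Section quadratic_objective.
Context {R : realType} (K : R -> R) (y h : R) (n m : nat) (Y : nat -> R).

(** The factor 2 comes from differentiating the square. *)
Definition weight (k : nat) : R := 2 * (n%:R * h)^-1 * Kh K h (y - Y k).

Definition slope (p : nat -> 'I_m -> R) (i : 'I_m) : R :=
  \sum_(1 <= k < n.+1) weight k * p k i.

Definition offset (p : nat -> 'I_m -> R) (i : 'I_m) : R :=
  \sum_(1 <= k < n.+1) weight k * p k i * Y k.+1.

(* Both [U_obj] and [u_obj] have this shape, with [p k i] the indicator,
   respectively the probability, of [x_(k+1) = i]. *)
Lemma grad_quadratic (p : nat -> 'I_m -> R) (th : 'rV[R]_m) :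
  grad (fun th : 'rV[R]_m => (n%:R * h)^-1 * \sum_(1 <= k < n.+1) \sum_(i < m)
     Kh K h (y - Y k) * p k i * (Y k.+1 - th 0 i) ^+ 2) th =
  \row_i (slope p i * th 0 i - offset p i).
Proof.
apply/rowP => i; rewrite !mxE.
apply: (@derive_quadratic _ _ _ _ _ _ (slope p i / 2)) => t.
rewrite /slope /offset !mulr_suml -sumrB !mulr_sumr -!big_split /=.
apply: eq_bigr => k _.
(* Only the summand of index [i] varies along the direction [i]. *)
rewrite (bigD1 i) //= [in RHS](bigD1 i) //= !mxE !eqxx /=.
rewrite (eq_bigr (fun j => Kh K h (y - Y k) * p k j * (Y k.+1 - th 0 j) ^+ 2)).
  by rewrite /weight; set q := (n%:R * h)^-1; field.
by move=> j ji; rewrite !mxE (negPf ji) andbF mulr0 add0r.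
Qed.

Definition hit (c : cfg n m) (k : nat) (i : 'I_m) : R := (c (inord k) == i)%:R.

Lemma grad_U_obj c th :
  grad (fun th => U_obj K y h Y th c) th =
  \row_i (slope (hit c) i * th 0 i - offset (hit c) i).
Proof. exact: grad_quadratic. Qed.

Lemma grad_u_obj (pi : cfg n m -> R) th :
  grad (u_obj K y h Y pi) th =
  \row_i (slope (marg pi) i * th 0 i - offset (marg pi) i).
Proof. exact: grad_quadratic. Qed.

Lemma marg_mean (pi : cfg n m -> R) k i :
  marg pi k i = \sum_c pi c * hit c k i.
Proof.
rewrite /marg big_mkcond; apply: eq_bigr => c _; rewrite /hit.
by case: eqP => _; rewrite ?mulr1 ?mulr0.
Qed.

(** With [offset_mean], this is the unbiasedness of the stochastic gradient: [marg] is the mean of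
    [hit], and the sums are exchanged. *)
Lemma slope_mean (pi : cfg n m -> R) i :
  slope (marg pi) i = \sum_c pi c * slope (hit c) i.
Proof.
rewrite /slope; under eq_bigr do rewrite marg_mean mulr_sumr.
rewrite exchange_big; apply: eq_bigr => c _; rewrite mulr_sumr.
by apply: eq_bigr => k _; ring.
Qed.

Lemma offset_mean (pi : cfg n m -> R) i :
  offset (marg pi) i = \sum_c pi c * offset (hit c) i.
Proof.
rewrite /offset; under eq_bigr do rewrite marg_mean mulr_sumr mulr_suml.
rewrite exchange_big; apply: eq_bigr => c _; rewrite mulr_sumr.
by apply: eq_bigr => k _; ring.
Qed.

Hypotheses (h_gt0 : 0 < h) (K_ge0 : is_kernel K).

Lemma weight_ge0 k : 0 <= weight k.
Proof. by rewrite !mulr_ge0 ?invr_ge0 ?mulr_ge0 ?K_ge0 // ltW. Qed.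

Lemma slope_hit_ge0 c i : 0 <= slope (hit c) i.
Proof. by apply: sumr_ge0 => k _; rewrite mulr_ge0 ?weight_ge0 ?ler0n. Qed.

(** A vanishing sum of nonnegative terms has only zero terms, and each of them is a factor of the
    matching term of the offset. *)
Lemma offset_eq0 c i : slope (hit c) i = 0 -> offset (hit c) i = 0.
Proof.
move/eqP; rewrite psumr_eq0 => [/allP s0|k _]; last first.
  by rewrite mulr_ge0 ?weight_ge0 ?ler0n.
rewrite /offset big_seq big1 // => k /s0 /eqP ->; exact: mul0r.
Qed.

Lemma sgd_iter_lsa (gamma : nat -> R) (th0 : 'rV[R]_m) (xs : nat -> cfg n m) t i :
  sgd_iter K y h Y gamma th0 xs t 0 i =
  lsa gamma (fun c => slope (hit c) i) (fun c => offset (hit c) i) (th0 0 i)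
    (hist xs t).
Proof.
by elim: t => [//|t IH] /=; rewrite grad_U_obj !mxE IH size_hist.
Qed.

End quadratic_objective.

(** * Conditional law in terms of histories, and conclusion *)

Lemma hist_rev (C : finType) (x : nat -> C) t :
  hist x t = rev [seq x j.+1 | j <- iota 0 t].
Proof.
by elim: t => [//|t IH]; rewrite -[in RHS]addn1 iotaD map_cat rev_cat /= IH.
Qed.

(** A history is the reversed listing of the finite function on ['I_t] used in [cond_law_pi], so its
    events are among those of the hypothesis at time [t.+1]. *)
Lemma cond_law_hist (R : realType) (n m : nat) (d : measure_display)
    (T : measurableType d) (P : probability T R) (X : nat -> T -> cfg n m)
    (pi : cfg n m -> R) :
  cond_law_pi P X pi -> forall t (B : pred (seq (cfg n m))) c,
  P (hist_event X t B `&` X t.+1 @^-1` [set c]) =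
  ((pi c)%:E * P (hist_event X t B))%E.
Proof.
move=> law t B c.
have hist_eq w : hist (X^~ w) t =
    rev [seq [ffun j : 'I_t => X j.+1 w] j | j <- enum 'I_t].
  rewrite (eq_map (g := (fun j => X j.+1 w) \o val)) => [|j]; last by rewrite ffunE.
  by rewrite map_comp val_enum_ord hist_rev.
rewrite /hist_event; under eq_set do rewrite hist_eq.
exact: (law t.+1 isT (fun f => B (rev [seq f j | j <- enum 'I_t])) c).
Qed.

Theorem theorem2 (R : realType) (y h : R) (K : R -> R) (n m : nat)
  (Y : nat -> R) (Theta : set 'rV[R]_m) (pi : cfg n m -> R)
  (d : measure_display) (T : measurableType d) (P : probability T R)
  (X : nat -> T -> cfg n m) (th0 : 'rV[R]_m) (gamma : nat -> R) :
  0 < h -> is_kernel K -> (0 < m)%N -> (0 < n)%N ->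
  open Theta -> convex_rV Theta ->
  is_prob_on_cfg pi ->
  (forall t (c : cfg n m), measurable (X t @^-1` [set c])) ->
  cond_law_pi P X pi ->
  Theta th0 ->
  (forall t, (0 < t)%N -> 0 < gamma t) ->
  ((fun N => \sum_(1 <= t < N) gamma t) @ \oo --> +oo) ->
  cvg ((fun N => \sum_(1 <= t < N) gamma t ^+ 2) @ \oo) ->
  (let thbar w := sgd_avg K y h Y gamma th0 (fun t => X t w) in
   {ae P, forall w, compact (closure (range (thbar w))) /\
                    closure (range (thbar w)) `<=` Theta}) ->
  let thbar w := sgd_avg K y h Y gamma th0 (fun t => X t w) in
  {ae P, forall w,
     (grad (u_obj K y h Y pi) (thbar w t) @[t --> \oo] --> (0 : 'rV[R]_m)) /\
     exists thstar : 'rV[R]_m,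
       (thbar w t @[t --> \oo] --> thstar) /\ grad (u_obj K y h Y pi) thstar = 0}.
Proof.
move=> h0 K0 _ _ _ _ [pi0 pi1] mX /cond_law_hist lawX _ g0 gsum gsqr _ thbar.
pose a i (c : cfg n m) := slope K y h n Y (hit c) i.
pose b i (c : cfg n m) := offset K y h n Y (hit c) i.
(* Characterizing the limit by a linear equation instead of a quotient also covers coordinates of
   zero slope, where the initial value serves as limit. *)
have /choice[xs xs_cvg] : forall i, exists x,
    slope K y h n Y (marg pi) i * x = offset K y h n Y (marg pi) i /\
    {ae P, forall w, lsa gamma (a i) (b i) (th0 0 i) (hist (X^~ w) t)
       @[t --> \oo] --> x}.
  move=> i; rewrite slope_mean offset_mean.
  have pia c : 0 <= pi c * a i c by rewrite mulr_ge0 // slope_hit_ge0.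
  have [A0|A0] := eqVneq (\sum_c pi c * a i c) 0.
    have pia0 c : pi c * a i c = 0.
      move/eqP: A0; rewrite psumr_eq0 // => /allP/(_ c).
      by rewrite mem_index_enum => /(_ isT)/eqP.
    have pib0 c : pi c * b i c = 0.
      have /eqP := pia0 c; rewrite mulf_eq0 => /orP[/eqP ->|/eqP a0].
        exact: mul0r.
      by rewrite /b offset_eq0 ?mulr0.
    exists (th0 0 i); split; last exact: (lsa_cvg_degenerate pi0 pi1).
    by rewrite A0 mul0r big1.
  exists ((\sum_c pi c * b i c) / (\sum_c pi c * a i c)); split.
    by rewrite mulrC divfK.
  apply: (lsa_cvg pi0 pi1) => //.
  by rewrite lt_neqAle eq_sym A0 sumr_ge0.
have : \forall w \ae P, forall i, lsa gamma (a i) (b i) (th0 0 i)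
    (hist (X^~ w) t) @[t --> \oo] --> xs i.
  by apply: filter_forall => i; exact: (xs_cvg i).2.
apply: filterS => w cvw.
have cvbar i : thbar w t 0 i @[t --> \oo] --> xs i.
  (* The shift passes over the separate value of the average at time 0 and matches the Cesaro mean
     of the iterates from time 1 on. *)
  rewrite -cvg_shiftS.
  have /cesaro : sgd_iter K y h Y gamma th0 (X^~ w) t.+1 0 i @[t --> \oo] --> xs i.
    rewrite (cvg_shiftS (fun t => sgd_iter K y h Y gamma th0 (X^~ w) t 0 i)).
    by under eq_fun do rewrite sgd_iter_lsa; exact: cvw.
  apply: cvg_trans; apply: near_eq_cvg; near=> t.
  rewrite /thbar /arithmetic_mean /series /= mxE summxE.
  by rewrite big_add1.
pose thstar := \row_i xs i.
have cvth : thbar w t @[t --> \oo] --> thstar.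
  by apply: cvg_row => i; rewrite mxE.
have grad0 : grad (u_obj K y h Y pi) thstar = 0.
  by rewrite grad_u_obj; apply/rowP => i; rewrite !mxE (xs_cvg i).1 subrr.
split; last by exists thstar.
(* The gradient is affine in each coordinate, so its limit is its value at [thstar]. *)
rewrite -grad0; apply: cvg_row => i.
under eq_fun do rewrite grad_u_obj mxE.
rewrite grad_u_obj mxE; apply: cvgB; last exact: cvg_cst.
by apply: cvgMr; rewrite mxE.
Unshelve. all: by end_near.
Qed.
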